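(* For every $p \in [2,\infty)$, every $d \in \mathbb{N}$ with $d \geq 4$, and every $f \in \ell^p(\mathbb{Z}^d)$, $$\Big\| \sup_{t \in \mathbb{D},\ t \leq \sqrt{d}} |\mathcal{M}_t^{B^1} f| \Big\|_{\ell^p(\mathbb{Z}^d)} \leq 40^{2/p}\, \| f \|_{\ell^p(\mathbb{Z}^d)} .$$
   Context: $\mathbb{N}=\{1,2,\dots\}$, $\mathbb{N}_0=\mathbb{N}\cup\{0\}$, and $\mathbb{D}=\{2^n : n\in\mathbb{N}_0\}$ is the set of dyadic integers. $B^1=\{x\in\mathbb{R}^d : \sum_{i=1}^d |x_i|\le 1\}$ and $t\cdot B^1=\{tx : x\in B^1\}$. For $t>0$ and $f:\mathbb{Z}^d\to\mathbb{C}$, the discrete Hardy-Littlewood averaging operator is $$\mathcal{M}_t^{B^1} f(x)=\frac{1}{|(t\cdot B^1)\cap\mathbb{Z}^d|}\sum_{y\in (t\cdot B^1)\cap\mathbb{Z}^d} f(x-y),\qquad x\in\mathbb{Z}^d,$$ where $|A|$ denotes the number of elements of a finite set $A$. *)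

(* Defs.v *)
From HB Require Import structures.
From mathcomp Require Import all_boot all_order all_algebra.
From mathcomp Require Import finmap complex.
From mathcomp Require Import all_classical all_reals all_analysis.

Set Implicit Arguments.
Unset Strict Implicit.
Unset Printing Implicit Defensive.

Import Order.TTheory GRing.Theory Num.Theory.

Local Open Scope classical_set_scope.
Local Open Scope ring_scope.

(* $\mathbb{D} = \{2^n : n \in \mathbb{N}_0\}$ *)
Definition dyadic (R : realType) : set R := [set 2 ^+ n | n in [set: nat]].
Arguments dyadic R : clear implicits.

Definition B1 (R : realType) (d : nat) : set 'rV[R]_d :=
  [set x | \sum_(i < d) `|x ord0 i| <= 1].
Arguments B1 R d : clear implicits.

(* $(t \cdot B^1) \cap \mathbb{Z}^d$, as a set of integer vectors; it is finite
   by [finite_lattice_B1] below, so that the finitely supported sum and the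
   cardinal of [fset_set] in [average_B1] are the intended ones. *)
Definition lattice_B1 (R : realType) (d : nat) (t : R) : set 'rV[int]_d :=
  [set y | [set t *: x | x in B1 R d] (map_mx intr y)].
Arguments lattice_B1 {R} d t.

Lemma finite_lattice_B1 (R : realType) (d : nat) (t : R) :
  finite_set (lattice_B1 d t).
Proof.
pose N := (Num.truncn `|t|).+1.
pose g (u : {ffun 'I_d -> 'I_(N + N).+1}) : 'rV[int]_d :=
  \row_i ((u i : nat)%:Z - N%:Z).
apply: (@sub_finite_set _ _ (g @` [set: {ffun 'I_d -> 'I_(N + N).+1}])); last first.
  by apply: finite_image; exact: finite_finset.
move=> y [x x1 xy] /=.
have yN (i : 'I_d) : `|y ord0 i| <= N%:Z.
  have yi : (y ord0 i)%:~R = t * x ord0 i :> R.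
    by have /rowP/(_ i) := xy; rewrite !mxE => ->.
  have xi : `|x ord0 i| <= 1.
    by apply: le_trans x1; rewrite (bigD1 i)//= lerDl sumr_ge0.
  rewrite -(ler_int R) intr_norm yi normrM -pmulrn.
  apply: (@le_trans _ _ `|t|); first exact: ler_piMr.
  by rewrite ltW// truncnS_gt.
exists [ffun i => inord (absz (y ord0 i + N%:Z))] => //.
apply/rowP => i; rewrite /g !mxE ffunE.
have := yN i; rewrite ler_norml => /andP[yN1 yN2].
have y0 : 0 <= y ord0 i + N%:Z by rewrite -lerBlDr sub0r.
rewrite inordK ?gez0_abs ?addrK//.
by rewrite ltnS -lez_nat gez0_abs// PoszD lerD2r.
Qed.

(* $\mathcal{M}_t^{B^1} f (x)$ *)
Definition average_B1 (R : realType) (d : nat) (t : R) (f : 'rV[int]_d -> R[i])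
    (x : 'rV[int]_d) : R[i] :=
  (#|` fset_set (lattice_B1 d t)|)%fset%:R^-1 *
  \sum_(y \in lattice_B1 d t) f (x - y).

(* The modulus of a complex number, [Num.norm] being [R[i]]-valued on [R[i]]. *)
Definition cmod (R : realType) (z : R[i]) : \bar R := (Normc.normc z)%:E.

(* The $\ell^p(\mathbb{Z}^d)$ norm, for $0 < p < \infty$, of (the modulus of) a
   function; [+oo] when the function is not in $\ell^p(\mathbb{Z}^d)$. *)
Definition lpnorm (R : realType) (d : nat) (p : R)
    (g : 'rV[int]_d -> \bar R) : \bar R :=
  ((\esum_(x in [set: 'rV[int]_d]) (`|g x| `^ p)) `^ p^-1)%E.

Definition in_lp (R : realType) (d : nat) (p : R) (f : 'rV[int]_d -> R[i]) :=
  (lpnorm p (fun x => cmod (f x)) < +oo)%E.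

(* $\sup_{t \in \mathbb{D}, t \le \sqrt{d}} |\mathcal{M}_t^{B^1} f(x)|$ *)
Definition dyadic_maximal_B1 (R : realType) (d : nat) (f : 'rV[int]_d -> R[i])
    (x : 'rV[int]_d) : \bar R :=
  ereal_sup [set cmod (average_B1 t f x) |
             t in [set t : R | dyadic R t /\ t <= Num.sqrt d%:R]].

(* Main.v *)
From HB Require Import structures.
Require Import Defs.
From mathcomp Require Import all_boot all_order all_algebra.
From mathcomp Require Import finmap complex zify ring lra.
From mathcomp Require Import all_classical all_reals all_analysis.

Import Order.TTheory GRing.Theory Num.Theory.

Local Open Scope ring_scope.

(* By Jensen's inequality |M_t f|^(p/2) <= M_t (|f|^(p/2)), so it suffices to
   bound the maximal function of a nonnegative g on l^2 with constant 40; the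
   bound is transferred to functions on a finite group (Z/L)^d.  There, let T_j
   be the average over the 2d+1 displacements 0, +-j e_i, put D = 2d+1 and
   b_n = n!/D^n * (sum over the ball of radius n).  Peeling off one displacement
   from a point of the ball yields, for n0^2 <= d, q = n0/D and n < n0,
     b_(n+1) <= T_1 b_n + sum_(1 <= j <= n) q^j T_(j+1) b_(n-j),
   whose second term e_n has norm at most 6 q |g|.  Duhamel's formula bounds b_n
   by T_1^n g + sum_(k < n) T_1^(n-1-k) e_k, and the dual form of Doob's
   inequality gives |sup_n T_1^n h| <= 4 |h|; as n0 q <= 1/2, the supremum over
   n <= n0 of b_n has norm at most 16 |g|.  Finally the ball of radius n <= n0
   has at least D^n / (2 n!) points, so the averages are at most 2 b_n. *)

(** * The $\ell^2$ inner product and norm on a finite set *)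

Section FiniteL2.
Context {R : rcfType} {G : finType}.
Implicit Types F H : G -> R.

Definition dot F H : R := \sum_u F u * H u.

Definition l2 F : R := Num.sqrt (dot F F).

Lemma dotC F H : dot F H = dot H F.
Proof. by apply: eq_bigr => u _; rewrite mulrC. Qed.

Lemma dotDl F1 F2 H : dot (F1 + F2) H = dot F1 H + dot F2 H.
Proof. by rewrite -big_split/=; apply: eq_bigr => u _; rewrite mulrDl. Qed.

Lemma dotDr H F1 F2 : dot H (F1 + F2) = dot H F1 + dot H F2.
Proof. by rewrite dotC dotDl !(dotC H). Qed.

Lemma dot_suml (I : Type) (r : seq I) (P : pred I) (f : I -> G -> R) H :
  dot (\sum_(i <- r | P i) f i) H = \sum_(i <- r | P i) dot (f i) H.
Proof.
rewrite /dot exchange_big/=; apply: eq_bigr => u _.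
by rewrite fct_sumE mulr_suml.
Qed.

Lemma ler_dot F1 F2 H : (forall u, 0 <= H u) -> (forall u, F1 u <= F2 u) ->
  dot F1 H <= dot F2 H.
Proof. by move=> H0 F12; apply: ler_sum => u _; rewrite ler_wpM2r. Qed.

Lemma dotFF_ge0 F : 0 <= dot F F.
Proof. by apply: sumr_ge0 => u _; rewrite -expr2 sqr_ge0. Qed.

Lemma l2_ge0 F : 0 <= l2 F. Proof. exact: sqrtr_ge0. Qed.

Lemma sqr_l2 F : l2 F ^+ 2 = dot F F.
Proof. by rewrite sqr_sqrtr// dotFF_ge0. Qed.

Lemma dot_le_l2 F H : dot F H <= l2 F * l2 H.
Proof.
have key a b : 2 * (a * b) * dot F H <= a ^+ 2 * dot F F + b ^+ 2 * dot H H.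
  rewrite /dot !mulr_sumr -big_split/=; apply: ler_sum => u _.
  by rewrite -subr_ge0 (_ : _ - _ = (a * F u - b * H u) ^+ 2) ?sqr_ge0//; ring.
have := l2_ge0 F; rewrite le_eqVlt => /predU1P[F0|F0].
  (* With [l2 F = 0] these weights give [(dot H H + 2) * dot F H ^+ 2 <= 0], hence [dot F H = 0]. *)
  have {key} := key (dot H H + 1) (dot F H).
  rewrite -(sqr_l2 F) -F0 mul0r expr0n/= mulr0 add0r.
  have := dotFF_ge0 H; nra.
have := l2_ge0 H; rewrite le_eqVlt => /predU1P[H0|H0].
  have {key} := key (dot F H) (dot F F + 1).
  rewrite -(sqr_l2 H) -H0 mulr0 expr0n/= mulr0 addr0.
  have := dotFF_ge0 F; nra.
have FH : 0 < l2 F * l2 H by exact: mulr_gt0.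
rewrite -(ler_pM2l FH); have := key (l2 H) (l2 F); rewrite -!sqr_l2.
by nra.
Qed.

Lemma l2_le F c : 0 <= c -> dot F F <= c ^+ 2 -> l2 F <= c.
Proof. by move=> c0 Fc; rewrite -(@ler_pXn2r _ 2)// ?nnegrE ?l2_ge0// sqr_l2. Qed.

Lemma l2D F H : l2 (F + H) <= l2 F + l2 H.
Proof.
apply: l2_le; first by rewrite addr_ge0 ?l2_ge0.
rewrite dotDl !dotDr (dotC H F) sqrrD !sqr_l2.
by have := dot_le_l2 F H; nra.
Qed.

Lemma l2_0 : l2 (0 : G -> R) = 0.
Proof. by rewrite /l2 /dot big1 ?sqrtr0// => u _; rewrite mul0r. Qed.

Lemma l2_sum (I : Type) (r : seq I) (P : pred I) (f : I -> G -> R) :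
  l2 (\sum_(i <- r | P i) f i) <= \sum_(i <- r | P i) l2 (f i).
Proof.
elim/big_rec2: _ => [|i a F _ Fa]; first by rewrite l2_0.
by apply: le_trans (l2D _ _) _; rewrite lerD2l.
Qed.

Lemma l2Z a F : 0 <= a -> l2 (a \*o F) = a * l2 F.
Proof.
move=> a0; rewrite -[X in X * l2 F](ger0_norm a0) -sqrtr_sqr -sqrtrM ?sqr_ge0//.
by rewrite /l2 /dot mulr_sumr; congr Num.sqrt; apply: eq_bigr => u _ /=; ring.
Qed.

Lemma ler_l2 F H : (forall u, 0 <= F u <= H u) -> l2 F <= l2 H.
Proof.
move=> FH; rewrite ler_sqrt ?dotFF_ge0//.
by apply: ler_sum => u _; have /andP[? ?] := FH u; rewrite ler_pM.
Qed.

End FiniteL2.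

(** * Maximal theorem for the iterates of a symmetric positive contraction *)

Section MaximalTheorem.
Context {R : rcfType} {G : finType}.
Variable T : {additive (G -> R) -> (G -> R)}.
Hypothesis T_sym : forall F H, dot (T F) H = dot F (T H).
Hypothesis T_contraction : forall F, l2 (T F) <= l2 F.
Hypothesis T_ge0 : forall F : G -> R, (forall u, 0 <= F u) -> forall u, 0 <= T F u.
Implicit Types F H : G -> R.

Lemma iter_ge0 n F : (forall u, 0 <= F u) -> forall u, 0 <= iter n T F u.
Proof. by move=> F0; elim: n => //= n IHn; exact: T_ge0. Qed.

Lemma iter_sym n F H : dot (iter n T F) H = dot F (iter n T H).
Proof. by elim: n F H => //= n IHn F H; rewrite T_sym IHn -iterSr. Qed.

(* The dual form of Doob's maximal inequality, for the reversed martingale of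
   the walk with transition operator [T]. No path space is needed: the
   inequality for [h 0, h 1, ...] follows from that for [T (h 1), T (h 2), ...]. *)
Lemma dual_maximal M (h : nat -> G -> R) :
  let Y := \sum_(m < M) iter m.*2 T (h m) in
  dot Y Y <= 2 * \sum_(m < M) dot (\sum_(n < m.+1) h n) (iter m.*2 T (h m)).
Proof.
elim: M h => [|M IHM] h /=.
  by rewrite !big_ord0 /dot big1 ?mulr0// => u _; rewrite mul0r.
pose Z := \sum_(m < M) iter m.*2 T (T (h m.+1)).
have TZ : \sum_(m < M) iter m.+1.*2 T (h m.+1) = T Z.
  by rewrite raddf_sum; apply: eq_bigr => m _; rewrite doubleS /= -iterSr.
have := IHM (fun n => T (h n.+1)); rewrite -/Z /= => Zle.
rewrite !big_ord_recl !big_ord0 addr0 /= TZ.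
have -> : \sum_(m < M) dot (\sum_(n < (bump 0 m).+1) h n)
              (iter (bump 0 m).*2 T (h (bump 0 m))) =
    dot (h 0%N) (T Z) +
    \sum_(m < M) dot (\sum_(n < m.+1) T (h n.+1)) (iter m.*2 T (T (h m.+1))).
  rewrite -TZ dotC dot_suml -big_split; apply: eq_bigr => m _.
  rewrite /bump leq0n add1n big_ord_recl dotDl [dot (iter _ _ _) _]dotC.
  congr (_ + _).
  under eq_bigr do rewrite /= /bump leq0n add1n.
  by rewrite -raddf_sum T_sym -iterSr doubleS.
rewrite dotDl !dotDr (dotC (T Z)).
have := T_contraction Z.
rewrite -(@ler_pXn2r _ 2)// ?nnegrE ?l2_ge0// !sqr_l2.
by have := dotFF_ge0 (h 0%N); nra.
Qed.

(** The supremum is linearised by a choice [k u] of the time at each point. Cutting [H] into its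
    restrictions [h n] to the level sets of [k], symmetry of [T] gives $|H|^2 = \langle Y,
    F\rangle$. The partial sums of [h] are at most [H], so [dual_maximal] yields $|Y|^2 \le 2\langle
    H, Y\rangle$, thus $|Y| \le 2|H|$ and $|H| \le 2|F|$. *)
Lemma maximal_even (k : G -> nat) F : (forall u, 0 <= F u) ->
  l2 (fun u => iter (k u).*2 T F u) <= 2 * l2 F.
Proof.
move=> F0; set H := fun u => _.
have H0 u : 0 <= H u by exact: iter_ge0.
pose M := (\max_u k u).+1.
have kM u : (k u < M)%N by rewrite ltnS leq_bigmax.
pose h n u : R := if k u == n then H u else 0.
have h0 n u : 0 <= h n u by rewrite /h; case: ifP.
pose Y := \sum_(m < M) iter m.*2 T (h m).
have HY : dot H H = dot Y F.
  rewrite dot_suml; under [RHS]eq_bigr do rewrite iter_sym.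
  rewrite exchange_big; apply: eq_bigr => u _.
  rewrite (bigD1 (Ordinal (kM u)))//= {1}/h eqxx big1 ?addr0// => n nk.
  rewrite /h ifN ?mul0r//; apply: contra nk => /eqP kn; apply/eqP/val_inj.
  by rewrite /= kn.
have YH : dot Y Y <= 2 * (l2 H * l2 Y).
  apply: le_trans (dual_maximal _ _) _; rewrite ler_pM2l//.
  apply: (@le_trans _ _ (dot Y H)); last by rewrite dotC dot_le_l2.
  rewrite dot_suml; apply: ler_sum => m _; rewrite [leRHS]dotC.
  apply: ler_dot => u; first exact: iter_ge0.
  rewrite fct_sumE; have [km|km] := ltnP (k u) m.+1.
    rewrite (bigD1 (Ordinal km))//= /h eqxx big1 ?addr0// => n nk.
    rewrite ifN//; apply: contra nk => /eqP kn; apply/eqP/val_inj.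
    by rewrite /= kn.
  by rewrite big1// => n _; rewrite /h ifN// gtn_eqF//; have := ltn_ord n; lia.
have Yle : l2 Y <= 2 * l2 H.
  move: YH; rewrite -sqr_l2; have := l2_ge0 Y; have := l2_ge0 H.
  by rewrite [0 <= l2 Y]le_eqVlt => ? /predU1P[<-|Y0]; nra.
have := dot_le_l2 Y F; rewrite -HY -sqr_l2.
have := l2_ge0 H; have := l2_ge0 F.
by rewrite [0 <= l2 H]le_eqVlt => ? /predU1P[<-|?]; nra.
Qed.

(** An odd iterate of [F] is an even iterate of [T F], so the even case is applied to both functions
    and the two bounds are added. *)
Lemma maximal_iter (k : G -> nat) F : (forall u, 0 <= F u) ->
  l2 (fun u => iter (k u) T F u) <= 4 * l2 F.
Proof.
move=> F0; have TF0 := T_ge0 F F0.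
pose E H u := iter (k u)./2.*2 T H u.
have E0 H u : (forall v, 0 <= H v) -> 0 <= E H u by move=> ?; exact: iter_ge0.
apply: (@le_trans _ _ (l2 (E F + E (T F)))).
  apply: ler_l2 => u; rewrite iter_ge0//=.
  rewrite -[X in iter X]odd_double_half addrfctE addnC iterD.
  by case: odd => /=; rewrite ?lerDl ?lerDr E0.
apply: le_trans (l2D _ _) _.
have := maximal_even (fun u => (k u)./2) F F0.
have := maximal_even (fun u => (k u)./2) (T F) TF0.
by have := T_contraction F; rewrite -/(E F) -/(E (T F)); lra.
Qed.

(** Written through a maximising index, which makes it an instance of the linearised supremum in
    [maximal_iter]. *)
Definition maxiter M F (u : G) : R :=
  iter [arg max_(n > ord0 : 'I_M.+1) iter n T F u]%O T F u.

Lemma le_maxiter M F n u : (n <= M)%N -> iter n T F u <= maxiter M F u.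
Proof.
rewrite /maxiter -ltnS => nM; case: arg_maxP => //= i _ imax.
exact: (imax (Ordinal nM)).
Qed.

Lemma l2_maxiter M F : (forall u, 0 <= F u) -> l2 (maxiter M F) <= 4 * l2 F.
Proof. exact: maximal_iter. Qed.

End MaximalTheorem.

Lemma ler_sum_inj (R : numDomainType) (I J : eqType) (s : seq I) (t : seq J)
    (g : I -> J) (f : J -> R) :
  uniq s -> uniq t -> {in s &, injective g} -> {in s, forall x, g x \in t} ->
  (forall y, 0 <= f y) -> \sum_(x <- s) f (g x) <= \sum_(y <- t) f y.
Proof.
move=> us ut injg gt f0; rewrite -(big_map g xpredT f).
rewrite [leRHS](bigID (mem (map g s)))/= -[leLHS]addr0 lerD ?sumr_ge0//.
rewrite -[X in _ <= X]big_filter le_eqVlt; apply/orP; left; apply/eqP.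
apply: perm_big; apply: uniq_perm.
- by rewrite map_inj_in_uniq.
- exact: filter_uniq.
- move=> y; rewrite mem_filter; apply/idP/andP => [ys|[]//].
  by split=> //; have /mapP[x xs ->] := ys; exact: gt.
Qed.

(** * Displacements between points of $\ell^1$ balls in $\mathbb{Z}^d$ *)

Section LatticeBall.
Context {d : nat}.
Implicit Types (y : 'rV[int]_d) (n j : nat).

Definition norm1 y : nat := (\sum_i `|y ord0 i|)%N.

(* The [2d] signed axes and a null direction; the latter makes up for the
   deficit [n - norm1 y] of the interior points [y] of a ball of radius [n], so
   that [sum_reaches] is an equality. *)
Definition direction : finType := (unit + 'I_d * bool)%type.

Definition displ j (o : direction) : 'rV[int]_d :=
  match o with
  | inl _ => 0
  | inr (i, b) => \row_k (if k == i then (if b then - j%:Z else j%:Z) else 0)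
  end.

(** The condition under which removing [displ j o] leads from the ball of radius [n] to that of
    radius [n - j]; see [norm1_subr]. *)
Definition reaches n j (o : direction) y : bool :=
  match o with
  | inl _ => (norm1 y + j <= n)%N
  | inr (i, b) => j%:Z <= (if b then - y ord0 i else y ord0 i)
  end.

(** The condition under which a unit move can afterwards be peeled off again; see [norm1_addr]. Both
    signs qualify at a zero coordinate. *)
Definition outward (o : direction) y : bool :=
  match o with
  | inl _ => true
  | inr (i, b) => 0 <= (if b then - y ord0 i else y ord0 i)
  end.

Lemma card_direction : #|{: direction}| = d.*2.+1.
Proof. by rewrite card_sum card_unit card_prod card_ord card_bool muln2. Qed.

Lemma sum_direction (F : direction -> nat) :
  (\sum_o F o = F (inl tt) + \sum_i (F (inr (i, true)) + F (inr (i, false))))%N.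
Proof.
rewrite big_sumType (eq_bigr (fun=> F (inl tt))) => [|[]//].
rewrite sum_nat_const card_unit mul1n; congr (_ + _)%N.
rewrite (eq_bigr (fun p => F (inr (p.1, p.2)))) => [|[]//].
rewrite -(pair_bigA _ (fun i b => F (inr (i, b)))).
by apply: eq_bigr => i _; rewrite big_bool.
Qed.

Lemma displN j (o : direction) :
  - displ j o = displ j (match o with inl _ => o | inr (i, b) => inr (i, ~~ b) end).
Proof.
case: o => [_|[i b]] /=; first by rewrite oppr0.
by apply/rowP => k; rewrite !mxE; case: eqP => _; case: b; rewrite ?oppr0 ?opprK.
Qed.

Lemma norm1_subr n j (o : direction) y :
  (norm1 y <= n)%N -> reaches n j o y -> (norm1 (y - displ j o) <= n - j)%N.
Proof.
case: o => [_|[i b]] /= yn; first by rewrite subr0 => ?; lia.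
move=> jy; move: yn; rewrite /norm1 (bigD1 i)//= [X in _ -> (X <= _)%N](bigD1 i)//=.
rewrite !mxE eqxx.
under [in X in _ -> (X <= _)%N]eq_bigr => k ki.
  rewrite !mxE (negbTE ki) subr0; over.
move: (y ord0 i) (\sum_(_ < d | _) _)%N jy => a s.
by case: b => /= ? ?; lia.
Qed.

Lemma norm1_addr (o : direction) y :
  outward o y ->
  reaches (norm1 y).+1 1 o (y + displ 1 o) /\ (norm1 (y + displ 1 o) <= (norm1 y).+1)%N.
Proof.
case: o => [_|[i b]] /=; first by rewrite addr0 addn1.
move=> yi; rewrite /norm1 (bigD1 i)//= [X in (_ <= X.+1)%N](bigD1 i)//=.
rewrite !mxE eqxx.
under eq_bigr => k ki do rewrite !mxE (negbTE ki) addr0.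
move: (y ord0 i) (\sum_(_ < d | _) _)%N yi => a s.
by case: b => /= ?; split; lia.
Qed.

Lemma sum_ord_ltn n k : (k <= n)%N -> (\sum_(j < n) (j < k)%N = k)%N.
Proof.
elim: n k => [|n IHn] k kn; first by rewrite big_ord0; lia.
rewrite big_ord_recr/=; have [->|kn'] := eqVneq k n.+1.
  rewrite (eq_bigr (fun j : 'I_n => (j < n)%N : nat)) ?IHn ?leqnn//; first by lia.
  by move=> j _; rewrite ltn_ord ltnW// ltnS ltn_ord.
by rewrite IHn; lia.
Qed.

(** Coordinate [i] accounts for [|y i|] pairs [(j, o)], all with the sign of [y i], and the null
    direction for the missing [n - norm1 y]. *)
Lemma sum_reaches n y : (norm1 y <= n)%N ->
  (\sum_(j < n) \sum_o reaches n j.+1 o y = n)%N.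
Proof.
move=> yn; under eq_bigr do rewrite sum_direction.
rewrite big_split/= -[RHS](subnK yn); congr (_ + _)%N.
  rewrite -[RHS](@sum_ord_ltn n) ?leq_subr//; apply: eq_bigr => j _.
  by congr nat_of_bool; lia.
rewrite exchange_big; apply: eq_bigr => i _.
have yi : (`|y ord0 i| <= n)%N.
  by apply: leq_trans yn; rewrite /norm1 (bigD1 i)//= leq_addr.
rewrite -[RHS](sum_ord_ltn n)//; apply: eq_bigr => j _.
by case: (y ord0 i) => m /=; lia.
Qed.

Lemma sum_reaches1 n y : (norm1 y <= n.+1)%N ->
  (\sum_o reaches n.+1 1 o y <= n.+1)%N.
Proof.
move=> yn; by rewrite -[leqRHS](sum_reaches _ _ yn) big_ord_recl/= leq_addr.
Qed.

(** At a coordinate [a] at least [2 - |a|] of the two signs are outward: both if [a = 0], one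
    otherwise. The null direction adds one. *)
Lemma sum_leaves n y : (norm1 y <= n)%N ->
  (d.*2.+1 - n <= \sum_o outward o y)%N.
Proof.
move=> yn; rewrite sum_direction /=.
suff : (d.*2 <= \sum_i (nat_of_bool (0 <= - y ord0 i)%R + nat_of_bool (0 <= y ord0 i)%R)
    + norm1 y)%N by move: (\sum_i _)%N => s /=; lia.
rewrite -big_split/= -[d.*2]muln2 -[X in (X * _)%N]card_ord -sum_nat_const.
by apply: leq_sum => i _; move: (y ord0 i) => a; lia.
Qed.

End LatticeBall.
Arguments direction : clear implicits.

(** * Recursive inequalities for sums over balls and for their cardinals *)

Section BallSums.
Variables (R : realType) (d : nat).
Notation ball n := (fset_set (lattice_B1 (R := R) d n%:R)).

Lemma mem_lattice_ball n (y : 'rV[int]_d) : (y \in ball n) = (norm1 y <= n)%N.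
Proof.
rewrite in_fset_set; last exact: finite_lattice_B1.
have normE : \sum_i `|(y ord0 i)%:~R| = (norm1 y)%:R :> R.
  rewrite /norm1 natr_sum; apply: eq_bigr => i _.
  by rewrite -intr_norm -abszE -pmulrn.
apply/idP/idP => [/set_mem[x x1 xy]|yn].
  have yE i : (y ord0 i)%:~R = n%:R * x ord0 i :> R.
    by have /rowP/(_ i) := xy; rewrite !mxE => ->.
  rewrite -(ler_nat R) -normE; under eq_bigr do rewrite yE normrM ger0_norm//.
  by rewrite -mulr_sumr ler_piMr.
(* For [n = 0] the inverse is [0] and so is this witness; then [y = 0] because [norm1 y = 0]. *)
apply/mem_set; exists (n%:R^-1 *: map_mx intr y).
  rewrite /B1/=; under eq_bigr do rewrite !mxE normrM ger0_norm ?invr_ge0//.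
  rewrite -mulr_sumr normE; have [->|n0] := posnP n; first by rewrite invr0 mul0r.
  by rewrite mulrC ler_pdivrMr ?ltr0n// mul1r ler_nat.
have [n0|n0] := posnP n; last by rewrite scalerA mulfV ?scale1r// pnatr_eq0 -lt0n.
rewrite n0 scale0r; apply/rowP => i; rewrite !mxE.
have : norm1 y == 0%N by rewrite -leqn0 -n0.
by rewrite /norm1 sum_nat_eq0 => /forallP/(_ i); rewrite /= absz_eq0 => /eqP ->.
Qed.

(** Double counting: by [sum_reaches] each [y] occurs for exactly [n] pairs [(j, o)], and for a
    fixed pair [y] is sent injectively into the smaller ball by removing the displacement. *)
Lemma sum_ball_le n (f : 'rV[int]_d -> R) : (forall y, 0 <= f y) ->
  n%:R * \sum_(y <- ball n) f y <=
  \sum_(j < n) \sum_(o : direction d) \sum_(z <- ball (n - j.+1)) f (z + displ j.+1 o).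
Proof.
move=> f0; rewrite mulr_sumr.
rewrite (eq_big_seq (fun y => \sum_(j < n) \sum_(o : direction d)
    (reaches n j.+1 o y)%:R * f y)); last first.
  move=> y; rewrite mem_lattice_ball => yn; rewrite -[in LHS](sum_reaches _ _ yn).
  rewrite natr_sum mulr_suml; apply: eq_bigr => j _.
  by rewrite natr_sum mulr_suml.
rewrite exchange_big; apply: ler_sum => j _.
rewrite exchange_big; apply: ler_sum => o _.
rewrite (eq_bigr (fun y => if reaches n j.+1 o y
    then f (y - displ j.+1 o + displ j.+1 o) else 0)); last first.
  by move=> y _; case: ifP; rewrite ?mul1r ?mul0r ?subrK.
rewrite -big_mkcond -big_filter.
apply: (@ler_sum_inj _ _ _ _ _ (fun y => y - displ j.+1 o)
  (fun z => f (z + displ j.+1 o))) => //.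
- exact/filter_uniq/fset_uniq.
- exact: fset_uniq.
- by move=> x y _ _; exact: addIr.
- move=> y; rewrite mem_filter !mem_lattice_ball => /andP[hy yn].
  exact: norm1_subr.
Qed.

(** Double counting of the outward unit moves from the ball of radius [n]: each point has at least
    [d.*2.+1 - n] of them, and each point of the larger ball is the end of at most [n.+1]. *)
Lemma card_ball_step n :
  (d.*2.+1 - n)%:R * (#|` ball n|)%fset%:R <= n.+1%:R * (#|` ball n.+1|)%fset%:R :> R.
Proof.
have cardE m : (#|` ball m|)%fset%:R = \sum_(y <- ball m) 1 :> R.
  by rewrite -sum1_size natr_sum.
rewrite !cardE !mulr_sumr.
apply: (@le_trans _ _ (\sum_(o : direction d) \sum_(y <- ball n | outward o y) 1)).
  under [leRHS]eq_bigr do rewrite big_mkcond/=.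
  rewrite exchange_big/= big_seq [leRHS]big_seq; apply: ler_sum => y.
  rewrite mem_lattice_ball => /sum_leaves yn.
  rewrite (eq_bigr (fun o => (outward o y)%:R)); last by move=> o _; case: (outward o y).
  by rewrite mulr1 -natr_sum ler_nat.
apply: (@le_trans _ _ (\sum_(o : direction d) \sum_(y <- ball n.+1 | reaches n.+1 1 o y) 1)).
  apply: ler_sum => o _; rewrite -big_filter -[leRHS]big_filter.
  apply: (@ler_sum_inj _ _ _ _ _ (fun y => y + displ 1 o) (fun=> 1)) => //.
  - exact/filter_uniq/fset_uniq.
  - exact/filter_uniq/fset_uniq.
  - by move=> x y _ _; exact: addIr.
  - move=> y; rewrite !mem_filter !mem_lattice_ball => /andP[hy yn].
    have [r le] := norm1_addr _ _ hy.
    rewrite (leq_trans le)// andbT; case: o {le hy} r => //= _.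
    by move/leq_trans; apply.
under eq_bigr do rewrite big_mkcond/=.
rewrite exchange_big/= big_seq [leRHS]big_seq; apply: ler_sum => y.
rewrite mem_lattice_ball => /sum_reaches1 yn.
rewrite (eq_bigr (fun o => (reaches n.+1 1 o y)%:R)); last first.
  by move=> o _; case: (reaches _ _ _ _).
by rewrite mulr1 -natr_sum ler_nat.
Qed.

(** By [card_ball_step], $X_m = m!\,|B_m|$ satisfies $(D-m)X_m \le X_{m+1}$. Induction gives $X_m
    \ge D^m(1 - m^2/(2D))$, stated without division in [Xge], and the bracket is at least $1/2$ when
    $m^2 \le d$. *)
Lemma card_ball_ge n : (n * n <= d)%N ->
  d.*2.+1%:R ^+ n <= 2 * (n`!)%:R * (#|` ball n|)%fset%:R :> R.
Proof.
set D : R := d.*2.+1%:R; set X := fun n => (n`!)%:R * (#|` ball n|)%fset%:R : R.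
have D0 : 0 < D by rewrite ltr0n.
have XS m : (m <= d)%N -> (D - m%:R) * X m <= X m.+1.
  move=> md; rewrite /X factS natrM -mulrA [leRHS]mulrCA [leLHS]mulrCA.
  rewrite ler_wpM2l// /D -natrB; last by lia.
  exact: card_ball_step.
have Xge m : (m <= d)%N -> D ^+ m * (2 * D - m%:R ^+ 2) <= 2 * D * X m.
  elim: m => [|m IHm] md.
    have ball0 : 1 <= (#|` ball 0|)%fset%:R :> R.
      rewrite ler1n cardfs_gt0; apply/fset0Pn; exists 0.
      by rewrite mem_lattice_ball /norm1 big1// => i _; rewrite mxE.
    by rewrite /X fact0 mul1r expr0n/=; nra.
  have /(ler_wpM2l (ltW D0)) := XS m (ltnW md).
  have /(ler_wpM2l (_ : 0 <= D - m%:R)) := IHm (ltnW md).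
  have mD : 0 <= D - m%:R by rewrite subr_ge0 ler_nat; lia.
  move=> /(_ mD); have : 0 <= m%:R :> R by [].
  have : 0 <= D ^+ m by rewrite exprn_ge0// ltW.
  rewrite [D ^+ m.+1]exprSr -[m.+1%:R]natr1; move: (D ^+ m) (X m) (X m.+1) m%:R => E A B x.
  move=> E0 x0 h1 h2.
  (* This is exactly the amount by which [(D - x) * E * (2 * D - x ^+ 2)] exceeds the left side
     required at the next index. *)
  have : 0 <= E * (x ^+ 3 + D) by rewrite mulr_ge0// addr_ge0 ?exprn_ge0// ltW.
  by lra.
move=> nd; have n_le : (n <= d)%N by nia.
have n2D : n%:R ^+ 2 <= D by rewrite -natrX ler_nat; lia.
have E0 : 0 < D ^+ n by rewrite exprn_gt0.
rewrite -mulrA -/(X n) -(ler_pM2l D0); apply: (@le_trans _ _ (2 * D * X n)).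
  by apply: le_trans (Xge n n_le); rewrite mulrC ler_pM2l//; lra.
by rewrite [leRHS]mulrCA mulrA.
Qed.

End BallSums.

(** * The $\ell^2$ maximal inequality on a finite abelian group *)

Section GroupMaximal.
Variables (R : realType) (G : finZmodType) (d : nat).
Variable phi : {additive 'rV[int]_d -> G}.
Implicit Types (F H : G -> R) (u : G).
Notation ball n := (fset_set (lattice_B1 (R := R) d n%:R)).
Let D : R := d.*2.+1%:R.

Let D_gt0 : 0 < D. Proof. by rewrite ltr0n. Qed.

Let invD_ge0 : 0 <= D^-1. Proof. by rewrite invr_ge0 ltW. Qed.

Definition transl (y : 'rV[int]_d) F u : R := F (u - phi y).

Lemma dot_transl y F H : dot (transl y F) H = dot F (transl (- y) H).
Proof.
rewrite /dot (reindex_inj (addrI (phi y)))/=; apply: eq_bigr => u _.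
by rewrite /transl raddfN opprK addrAC subrr add0r addrC.
Qed.

Lemma l2_transl y F : l2 (transl y F) = l2 F.
Proof.
rewrite /l2 dot_transl; congr (Num.sqrt (dot _ _)).
by apply/funext => u; rewrite /transl raddfN opprK addrK.
Qed.

Definition walk j F : G -> R :=
  D^-1 \*o \sum_(o : direction d) transl (displ j o) F.

Lemma walkE j F u : walk j F u = D^-1 * \sum_o F (u - phi (displ j o)).
Proof. by rewrite /walk/= fct_sumE. Qed.

Lemma walk_is_zmod_morphism j : zmod_morphism (walk j).
Proof.
move=> F H; apply/funext => u; rewrite !fctE !walkE -mulrBr -sumrB.
by [].
Qed.
HB.instance Definition _ j :=
  GRing.isZmodMorphism.Build (G -> R) (G -> R) (walk j) (walk_is_zmod_morphism j).

(** The adjoint of a translation is the opposite translation, and flipping signs permutes the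
    directions. *)
Lemma walk_sym j F H : dot (walk j F) H = dot F (walk j H).
Proof.
have walkD F' : walk j F' = \sum_(o : direction d) D^-1 \*o transl (displ j o) F'.
  by apply/funext => u; rewrite walkE fct_sumE mulr_sumr.
pose flip (o : direction d) : direction d :=
  match o with inl _ => o | inr (i, b) => inr (i, ~~ b) end.
have flipK : involutive flip by case=> [[]|[i b]]//=; rewrite negbK.
rewrite dotC !walkD dotC [RHS]dotC !dot_suml.
rewrite (reindex_inj (inv_inj flipK)); apply: eq_bigr => o _.
have -> K K' y : dot (D^-1 \*o transl y K) K' = D^-1 * dot (transl y K) K'.
  by rewrite /dot mulr_sumr; apply: eq_bigr => u _; rewrite /= mulrA.
have -> K K' y : dot (D^-1 \*o transl y K) K' = D^-1 * dot (transl y K) K'.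
  by rewrite /dot mulr_sumr; apply: eq_bigr => u _; rewrite /= mulrA.
by rewrite dot_transl dotC displN -/(flip _) flipK.
Qed.

Lemma l2_walk j F : l2 (walk j F) <= l2 F.
Proof.
rewrite l2Z// ler_pdivrMl//.
apply: le_trans (l2_sum _ _ _ _) _; under eq_bigr do rewrite l2_transl.
by rewrite sumr_const card_direction mulr_natl.
Qed.

Lemma ler_walk j F H : (forall u, F u <= H u) -> forall u, walk j F u <= walk j H u.
Proof.
move=> FH u; rewrite !walkE ler_wpM2l//.
by apply: ler_sum => o _; exact: FH.
Qed.

Lemma walk_ge0 j F : (forall u, 0 <= F u) -> forall u, 0 <= walk j F u.
Proof.
move=> F0 u; rewrite walkE mulr_ge0//.
by apply: sumr_ge0 => o _; exact: F0.
Qed.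

Let c n : R := (n`!)%:R / D ^+ n.

Let c_gt0 n : 0 < c n.
Proof. by rewrite divr_gt0 ?exprn_gt0// ltr0n fact_gt0. Qed.

Let c_ge0 n : 0 <= c n. Proof. exact: ltW. Qed.

Definition ballsum n F u : R := c n * \sum_(y <- ball n) F (u - phi y).

Lemma ballsum_ge0 n F : (forall u, 0 <= F u) -> forall u, 0 <= ballsum n F u.
Proof. by move=> F0 u; rewrite mulr_ge0 // sumr_ge0. Qed.

Variable n0 : nat.
Hypothesis n0_le : (n0 * n0 <= d)%N.
Let q : R := n0%:R / D.

Let q_ge0 : 0 <= q. Proof. by rewrite divr_ge0// ltW. Qed.

Let q_le : 3 * q <= 1.
Proof.
rewrite /q mulrA ler_pdivrMr// mul1r -natrM ler_nat.
by case: n0 n0_le => [|[|m]]; lia.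
Qed.

Let qn0_le : 2 * (n0%:R * q) <= 1.
Proof. by rewrite /q !mulrA ler_pdivrMr// mul1r -!natrM ler_nat; nia. Qed.

(** Each ratio $c_{m+1}/c_m = (m+1)/D$ with $m < n_0$ is at most $q$. *)
Let c_le n j : (j <= n <= n0)%N -> c n <= q ^+ j * c (n - j).
Proof.
elim: j => [|j IHj] /andP[jn nn0]; first by rewrite expr0 mul1r subn0.
apply: le_trans (IHj _) _; first by rewrite (ltnW jn).
rewrite exprSr -mulrA ler_wpM2l ?exprn_ge0//.
rewrite -(subnSK jn); set m := (n - j.+1)%N.
rewrite /c factS natrM exprSr invfM mulrACA mulrC.
rewrite [X in X <= _](_ : _ = m.+1%:R / D * c m); last by rewrite /c; ring.
rewrite ler_wpM2r // /q ler_wpM2r//.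
by rewrite ler_nat /m; lia.
Qed.

(** This is [sum_ball_le] at radius [n.+1], whose factor [n.+1] is absorbed by [c n.+1]. A move of
    length [j.+1] leaves radius [n - j], and [c_le] trades [c n] for [q ^+ j * c (n - j)]. *)
Lemma ballsum_rec n F u : (forall v, 0 <= F v) -> (n < n0)%N ->
  ballsum n.+1 F u <= \sum_(j < n.+1) q ^+ j * walk j.+1 (ballsum (n - j) F) u.
Proof.
move=> F0 nn0.
have cS : c n.+1 = D^-1 * c n * n.+1%:R.
  by rewrite /c factS natrM exprS invfM; ring.
rewrite /ballsum cS -[leLHS]mulrA.
have /(ler_wpM2l (mulr_ge0 invD_ge0 (c_ge0 n))) :=
  sum_ball_le R d n.+1 _ (fun y => F0 (u - phi y)).
move=> /le_trans; apply.
rewrite mulr_sumr; apply: ler_sum => j _; rewrite subSS walkE -[leLHS]mulrA [leRHS]mulrCA.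
rewrite ler_wpM2l// [leLHS]mulr_sumr [leRHS]mulr_sumr; apply: ler_sum => o _.
under [in leLHS]eq_bigr do rewrite raddfD [phi _ + _]addrC opprD addrA.
rewrite [leRHS]mulrA; apply: ler_wpM2r; first by rewrite sumr_ge0.
by rewrite c_le// -ltnS ltn_ord ltnW.
Qed.

(** The moves of length at least 2 in [ballsum_rec], treated as a perturbation of [walk 1]. *)
Definition long_moves n F : G -> R :=
  \sum_(j < n) (q ^+ j.+1 \*o walk j.+2 (ballsum (n - j.+1) F)).

Lemma long_moves_ge0 n F : (forall u, 0 <= F u) -> forall u, 0 <= long_moves n F u.
Proof.
move=> F0 u; rewrite /long_moves fct_sumE; apply: sumr_ge0 => j _.
by rewrite mulr_ge0 ?exprn_ge0// walk_ge0// => v; exact: ballsum_ge0.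
Qed.

Lemma ballsumS_le n F u : (forall v, 0 <= F v) -> (n < n0)%N ->
  ballsum n.+1 F u <= walk 1 (ballsum n F) u + long_moves n F u.
Proof.
move=> F0 nn0; apply: le_trans (ballsum_rec _ _ _ F0 nn0) _.
by rewrite big_ord_recl/= expr0 mul1r subn0 /long_moves fct_sumE.
Qed.

Lemma ballsum0 F : ballsum 0 F = F.
Proof.
apply/funext => u; rewrite /ballsum /c fact0 expr0 divr1 mul1r.
have -> : ball 0 = [fset 0]%fset.
  apply/fsetP => y; rewrite mem_lattice_ball in_fset1 leqn0 sum_nat_eq0.
  apply/forallP/eqP => [y0|-> i]; last by rewrite mxE.
  by apply/rowP => i; have := y0 i; rewrite mxE absz_eq0 => /eqP.
by rewrite big_seq_fset1 raddf0 subr0.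
Qed.

(** The geometric series is at most $q/(1-q) \le 3q/2$ since $3q \le 1$; the assumed factor 4 turns
    this into $6q$. *)
Lemma l2_long_moves n F : (forall u, 0 <= F u) ->
  (forall m, (m < n)%N -> l2 (ballsum m F) <= 4 * l2 F) ->
  l2 (long_moves n F) <= 6 * q * l2 F.
Proof.
move=> F0 le4; apply: le_trans (l2_sum _ _ _ _) _.
apply: (@le_trans _ _ (\sum_(j < n) q ^+ j.+1 * (4 * l2 F))).
  apply: ler_sum => j _; rewrite l2Z ?exprn_ge0// ler_wpM2l ?exprn_ge0//.
  by apply: le_trans (l2_walk _ _) _; apply: le4; have := ltn_ord j; lia.
rewrite -mulr_suml.
have geom : (1 - q) * \sum_(j < n) q ^+ j.+1 <= q.
  under eq_bigr do rewrite exprS.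
  rewrite -mulr_sumr mulrCA -[1 - q]opprB mulNr -subrX1 opprB.
  by rewrite ler_piMr// gerBl exprn_ge0.
have sum_ge0 : 0 <= \sum_(j < n) q ^+ j.+1.
  by apply: sumr_ge0 => j _; rewrite exprn_ge0.
rewrite mulrA ler_wpM2r ?l2_ge0//.
by have := q_le; nra.
Qed.

Lemma l2_ballsum n F : (forall u, 0 <= F u) -> (n <= n0)%N ->
  l2 (ballsum n F) <= 4 * l2 F.
Proof.
(* The induction runs on the finer constant $1 + 6qn$, which grows by the norm of one long-move term
   per step and stays below 4 because $2 n_0 q \le 1$. *)
move=> F0 nn0; apply: (@le_trans _ _ ((1 + 6 * q * n%:R) * l2 F)); last first.
  rewrite ler_wpM2r ?l2_ge0//.
  have : n%:R <= n0%:R :> R by rewrite ler_nat.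
  by have := qn0_le; have := q_ge0; nra.
elim/ltn_ind: n nn0 => -[|n] IHn nn0.
  by rewrite ballsum0 mulr0 addr0 mul1r.
have IHn' m : (m < n.+1)%N -> l2 (ballsum m F) <= 4 * l2 F.
  move=> mn; apply: le_trans (IHn _ mn _) _; first by lia.
  rewrite ler_wpM2r ?l2_ge0//.
  have : m%:R <= n0%:R :> R by rewrite ler_nat; lia.
  by have := qn0_le; have := q_ge0; nra.
apply: (@le_trans _ _ (l2 (walk 1 (ballsum n F) + long_moves n F))).
  apply: ler_l2 => u; rewrite ballsum_ge0//=; exact: ballsumS_le.
apply: le_trans (l2D _ _) _.
have := l2_walk 1 (ballsum n F); have := IHn n (ltnSn n) (ltnW nn0).
have := l2_long_moves _ _ F0 (fun m mn => IHn' m (ltnW mn)).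
by rewrite -natr1; lra.
Qed.

(** Iteration of [ballsumS_le]; positivity of the walk allows it to be applied to the inductive
    bound. *)
Lemma ballsum_duhamel n F u : (forall v, 0 <= F v) -> (n <= n0)%N ->
  ballsum n F u <= iter n (walk 1) F u +
    \sum_(k < n) iter (n - k.+1) (walk 1) (long_moves k F) u.
Proof.
move=> F0; elim: n u => [|n IHn] u nn0; first by rewrite ballsum0 big_ord0 addr0.
apply: le_trans (ballsumS_le _ _ _ F0 nn0) _.
rewrite big_ord_recr/= subnn/= addrA lerD2r.
pose E := iter n (walk 1) F +
  \sum_(k < n) iter (n - k.+1) (walk 1) (long_moves k F).
apply: (@le_trans _ _ (walk 1 E u)).
  by apply: ler_walk => v; rewrite /E fctE fct_sumE IHn// ltnW.
rewrite /E raddfD raddf_sum fctE fct_sumE lerD2l; apply: ler_sum => k _.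
by rewrite -iterS -subSn.
Qed.

Definition ball_average n F u : R :=
  (#|` ball n|)%fset%:R^-1 * \sum_(y <- ball n) F (u - phi y).

(** Replacing every iterate in [ballsum_duhamel] by the maximal function of its argument gives a
    majorant [H] independent of [n]. *)
Lemma ball_maximal F : (forall u, 0 <= F u) ->
  exists H, (forall n u, (n <= n0)%N -> ball_average n F u <= H u) /\
            l2 H <= 32 * l2 F.
Proof.
move=> F0; pose M := maxiter (walk 1) n0.
exists (2 \*o (M F + \sum_(k < n0) M (long_moves k F))); split.
  move=> n u nn0.
  have avg_le : ball_average n F u <= 2 * ballsum n F u.
    rewrite /ball_average /ballsum mulrA ler_wpM2r ?sumr_ge0//.
    have := card_ball_ge R d n (leq_trans (leq_mul nn0 nn0) n0_le).
    rewrite -/D /c; set b : R := (#|` _|)%fset%:R => Dle.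
    have Dn0 : 0 < D ^+ n by rewrite exprn_gt0.
    have b0 : 0 < b.
      rewrite lt0r /b ler0n andbT; apply/negP => /eqP b0.
      by move: Dle; rewrite /b b0 mulr0 leNgt Dn0.
    rewrite mulrA ler_pdivlMr// mulrC ler_pdivrMr//.
  apply: (le_trans avg_le); rewrite /= ler_pM2l//.
  apply: le_trans (ballsum_duhamel _ _ _ F0 nn0) _.
  rewrite fctE fct_sumE lerD ?le_maxiter//.
  apply: (@le_trans _ _ (\sum_(k < n) M (long_moves k F) u)).
    by apply: ler_sum => k _; apply: le_maxiter; lia.
  (* The sum over [k < n] is extended to [k < n0] by nonnegative terms. *)
  rewrite (big_ord_widen n0 (fun k => M (long_moves k F) u) nn0) big_mkcond.
  apply: ler_sum => k _; case: ifP => // _.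
  apply: le_trans (le_maxiter _ _ _ 0%N _ (leq0n _)); exact: long_moves_ge0.
have lm F' := l2_maxiter _ (walk_sym 1) (l2_walk 1) (walk_ge0 1) n0 F'.
(* Since $n_0 q \le 1/2$, the constant is $2(4 + 24 n_0 q) \le 32$. *)
rewrite l2Z//; apply: (@le_trans _ _ (2 * (4 * l2 F + \sum_(k < n0) 4 * (6 * q * l2 F)))).
  rewrite ler_pM2l//; apply: le_trans (l2D _ _) _; rewrite lerD ?lm//.
  apply: le_trans (l2_sum _ _ _ _) _; apply: ler_sum => k _.
  apply: le_trans (lm _ (long_moves_ge0 _ _ F0)) _; rewrite ler_pM2l//.
  apply: l2_long_moves => // m mk; apply: l2_ballsum => //.
  by have := ltn_ord k; lia.
rewrite sumr_const card_ord -mulr_natl.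
by have := l2_ge0 F; have := qn0_le; nra.
Qed.

End GroupMaximal.

(** * Transference from the finite group to $\mathbb{Z}^d$ *)

Section Transference.
Variables (R : realType) (d : nat).
Notation ball n := (fset_set (lattice_B1 (R := R) d n%:R)).

Definition lattice_average n (g : 'rV[int]_d -> R) x : R :=
  (#|` ball n|)%fset%:R^-1 * \sum_(y <- ball n) g (x - y).

Lemma intr_Zp_eq0 (L : nat) (a : int) :
  (1 < L)%N -> (`|a| < L)%N -> a%:~R = 0 :> 'Z_L -> a = 0.
Proof.
move=> L1; have natr0 k : (k < L)%N -> k%:R = 0 :> 'Z_L -> k = 0%N.
  by move=> kL /(congr1 val); rewrite /= val_Zp_nat// modn_small.
case: a => k /= kL; first by move=> /(natr0 _ kL) ->.
by rewrite NegzE mulrNz => /eqP; rewrite oppr_eq0 => /eqP /(natr0 _ kL).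
Qed.

(** [N] selects a radius at each point. The averages at points of [X] only see values of [g] on the
    finite set [Y], which embeds in $(\mathbb{Z}/L)^d$ for large $L$; there [ball_maximal] applies
    to the image of [g] restricted to [Y]. *)
Lemma lattice_maximal (n0 : nat) (g : 'rV[int]_d -> R) (X : seq 'rV[int]_d)
    (N : 'rV[int]_d -> nat) :
  (n0 * n0 <= d)%N -> (forall x, (N x <= n0)%N) -> (forall x, 0 <= g x) ->
  uniq X ->
  exists2 Y : seq 'rV[int]_d, uniq Y &
    \sum_(x <- X) lattice_average (N x) g x ^+ 2 <=
    32 ^+ 2 * \sum_(y <- Y) g y ^+ 2.
Proof.
move=> n0d Nn0 g0 uX.
pose Y := undup [seq x - y | x <- X, y <- enum_fset (ball n0)].
have uY : uniq Y by exact: undup_uniq.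
exists Y => //.
have memY x y : x \in X -> y \in ball n0 -> x - y \in Y.
  by move=> xX yb; rewrite mem_undup; apply/allpairsP; exists (x, y).
have XY x : x \in X -> x \in Y.
  move=> xX; rewrite -[x]subr0 memY// mem_lattice_ball /norm1 big1// => i _.
  by rewrite mxE.
pose K := \max_(y <- Y) norm1 y.
have YK y i : y \in Y -> (`|y ord0 i| <= K)%N.
  move=> yY; apply: leq_trans (leq_bigmax_seq _ yY isT).
  by rewrite /norm1 (bigD1 i)//= leq_addr.
(* Coordinates of two points of [Y] differ by at most [2K], so this modulus separates them; it is
   also at least 2, as ['Z_L] requires to have modulus [L]. *)
pose phi : {additive 'rV[int]_d -> 'rV['Z_(K.*2.+2)]_d} := map_mx intr.
have phi_inj : {in Y &, injective phi}.
  move=> y z yY zY /eqP; rewrite -subr_eq0 -raddfB => /eqP/rowP yz.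
  apply/rowP => i; apply/eqP; rewrite -subr_eq0; apply/eqP.
  apply: (@intr_Zp_eq0 K.*2.+2) => //.
    have dist (a b : int) k :
      (`|a| <= k)%N -> (`|b| <= k)%N -> (`|(a - b)%R| < k.*2.+2)%N by lia.
    exact: dist (YK y i yY) (YK z i zY).
  by have := yz i; rewrite !mxE.
pose F u := \sum_(y <- Y) (if phi y == u then g y else 0).
have F0 u : 0 <= F u by apply: sumr_ge0 => y _; case: ifP.
have FE y : y \in Y -> F (phi y) = g y.
  move=> yY; rewrite /F (bigD1_seq y)//= eqxx big1_seq ?addr0// => z /andP[zy zY].
  by rewrite ifN//; apply: contra zy => /eqP/phi_inj ->.
have dotF : dot F F = \sum_(y <- Y) g y ^+ 2.
  rewrite /dot {1}/F; under eq_bigr do rewrite mulr_suml.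
  rewrite exchange_big; apply: eq_big_seq => y yY.
  rewrite (bigD1 (phi y))//= eqxx FE// big1 ?addr0 ?expr2// => u uy.
  by rewrite eq_sym (negbTE uy) mul0r.
have [H [leH l2H]] := ball_maximal R _ d phi n0 n0d F F0.
have avg_le x : x \in X -> lattice_average (N x) g x <= H (phi x).
  move=> xX; apply: le_trans (leH _ _ (Nn0 x)).
  rewrite ler_wpM2l ?invr_ge0// big_seq [leRHS]big_seq; apply: ler_sum => y.
  rewrite mem_lattice_ball => yN; rewrite -raddfB FE// memY//.
  by rewrite mem_lattice_ball (leq_trans yN).
have avg_ge0 x : 0 <= lattice_average (N x) g x.
  by rewrite mulr_ge0 ?invr_ge0// sumr_ge0.
rewrite -dotF -sqr_l2 -exprMn.
apply: (@le_trans _ _ (l2 H ^+ 2)); last by rewrite ler_pXn2r ?nnegrE ?mulr_ge0 ?l2_ge0.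
apply: (@le_trans _ _ (\sum_(x <- X) H (phi x) ^+ 2)).
  rewrite big_seq [leRHS]big_seq; apply: ler_sum => x xX.
  by rewrite ler_pXn2r ?nnegrE ?(le_trans _ (avg_le _ xX)) ?avg_le.
rewrite sqr_l2 /dot; under [leRHS]eq_bigr do rewrite -expr2.
apply: (@ler_sum_inj _ _ _ _ _ phi (fun u => H u ^+ 2)) => //.
- exact: index_enum_uniq.
- by move=> x y xX yX; apply: phi_inj; exact: XY.
- by move=> x _; exact: mem_index_enum.
- by move=> u; exact: sqr_ge0.
Qed.

End Transference.

(* Young's inequality [a * A^(r-1) <= a^r / r + A^r / r'] is the tangent line
   inequality for [x^r] at the mean [A]. *)
Lemma mean_powR (R : realType) (I : Type) (s : seq I) (a : I -> R) (r : R) :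
  1 <= r -> (forall i, 0 <= a i) ->
  ((size s)%:R^-1 * \sum_(i <- s) a i) `^ r <=
  (size s)%:R^-1 * \sum_(i <- s) a i `^ r.
Proof.
move=> r1 a0; set n : R := (size s)%:R; set A := n^-1 * _.
have r0 : 0 < r by exact: lt_le_trans r1.
have A0 : 0 <= A by rewrite mulr_ge0 ?invr_ge0// sumr_ge0.
have [r_eq|rn1] := eqVneq r 1.
  rewrite r_eq powRr1//; under eq_bigr do rewrite powRr1//.
  by [].
have := A0; rewrite le_eqVlt => /predU1P[<-|A_gt0].
  by rewrite powR0 ?gt_eqF// mulr_ge0 ?invr_ge0// sumr_ge0// => i _; exact: powR_ge0.
have n0 : 0 < n.
  rewrite lt0r ler0n andbT; apply/negP => /eqP n0; move: A_gt0.
  by rewrite /A n0 invr0 mul0r ltxx.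
have r_gt1 : 1 < r by rewrite lt_neqAle eq_sym rn1.
pose B := A `^ (r - 1).
have AB : A * B = A `^ r by rewrite /B -{1}(powRr1 A0) -powRD ?subrKC ?gt_eqF ?implybT.
have young i : a i * B <= a i `^ r / r + A `^ r * (1 - r^-1).
  have := @conjugate_powR R (a i) B r (r / (r - 1)) (a0 i) (powR_ge0 _ _) r0.
  have -> : (r / (r - 1))^-1 = 1 - r^-1 by field; rewrite gt_eqF//= subr_eq0.
  rewrite divr_gt0 ?subr_gt0// => /(_ isT); rewrite subrKC => /(_ erefl).
  rewrite /B -powRrM mulrCA mulfV ?mulr1// subr_eq0//.
have : A * B <= n^-1 * \sum_(i <- s) (a i `^ r / r + A `^ r * (1 - r^-1)).
  rewrite /A -mulrA mulr_suml ler_wpM2l ?invr_ge0 ?(ltW n0)//.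
  by apply: ler_sum => i _; exact: young.
rewrite AB big_split/= -mulr_suml big_const_seq count_predT iter_addr_0.
rewrite -[_ *+ size s]mulr_natl -/n mulrDr mulKf ?gt_eqF// mulrA.
move=> h; rewrite -(ler_pM2r (_ : 0 < r^-1)) ?invr_gt0//; lra.
Qed.

(** * The dyadic maximal function and the passage from $\ell^2$ to $\ell^p$ *)

Lemma normc_nat (R : realType) (n : nat) : Normc.normc (n%:R : R[i]) = n%:R.
Proof. by rewrite normcMn Normc.normc1. Qed.

Lemma normc_average_le (R : realType) (d n : nat) (f : 'rV[int]_d -> R[i]) x :
  Normc.normc (average_B1 (n%:R : R) f x) <=
  lattice_average R d n (fun z => Normc.normc (f z)) x.
Proof.
rewrite /average_B1 /lattice_average Normc.normcM Normc.normcV normc_nat.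
rewrite ler_wpM2l ?invr_ge0//.
rewrite fsbig_finite; last exact: finite_lattice_B1.
elim/big_rec2: _ => [|y a b _ ab]; first by rewrite Normc.normc0.
by apply: le_trans (le_normcD _ _) _; rewrite lerD2l.
Qed.

(** Dyadic radii are natural numbers, so the supremum is at most a maximum over the integer radii up
    to [n0], the integer part of $\sqrt d$; a maximising radius is selected at each [x]. *)
Lemma dyadic_maximal_le (R : realType) (d : nat) (f : 'rV[int]_d -> R[i]) :
  (0 < d)%N ->
  exists n0, (n0 * n0 <= d)%N /\ forall x, exists n, (n <= n0)%N /\
    (0 <= dyadic_maximal_B1 f x <=
       (lattice_average R d n (fun z => Normc.normc (f z)) x)%:E)%E.
Proof.
move=> d0; pose n0 := Num.truncn (Num.sqrt d%:R : R).
have le_n0 m : (m%:R <= Num.sqrt d%:R :> R) -> (m <= n0)%N.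
  by move=> md; rewrite truncn_ge_nat ?sqrtr_ge0.
exists n0; split.
  rewrite -(ler_nat R) natrM -expr2 -[leRHS]sqr_sqrtr//.
  by rewrite ler_pXn2r ?nnegrE ?sqrtr_ge0// truncn_le sqrtr_ge0.
move=> x; pose A n := Normc.normc (average_B1 (n%:R : R) f x).
pose n := [arg max_(n > ord0 : 'I_n0.+1) A n]%O.
exists (n : nat); split; first by rewrite -ltnS.
apply/andP; split.
  (* Radius 1 is admissible as [d] is positive, so the supremum is not the value [-oo] of an empty
     one. *)
  apply: (@le_trans _ _ (cmod (average_B1 (1 : R) f x))).
    by rewrite /cmod lee_fin; case: (average_B1 _ _ _) => a b; exact: sqrtr_ge0.
  apply: ereal_sup_ubound; exists 1 => //; split; first by exists 0%N.
  by rewrite -[leLHS]sqrtr1 ler_sqrt// ler1n.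
apply: ge_ereal_sup => _ [t [[k _ <-] kd] <-].
rewrite /cmod lee_fin; apply: le_trans (normc_average_le _ _ _ _ _).
rewrite -natrX in kd *; rewrite -/(A _) -/(A n).
rewrite /n; case: arg_maxP => //= i _ imax.
have k_n0 : (2 ^ k < n0.+1)%N by rewrite ltnS le_n0.
exact: (imax (Ordinal k_n0)).
Qed.

(** The infinite sum is a supremum over finite sets [X]. On each of them [mean_powR] with exponent
    [p / 2] reduces to squares of averages of [g], and the finite set [Y] of [lattice_maximal] is a
    competitor for the sum on the right. *)
Lemma esum_dyadic_maximal_le (R : realType) (p : R) (d : nat)
    (f : 'rV[int]_d -> R[i]) :
  2 <= p -> (0 < d)%N ->
  (\esum_(x in [set: 'rV[int]_d]) (`|dyadic_maximal_B1 f x| `^ p) <=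
   (40 ^+ 2)%:E * \esum_(x in [set: 'rV[int]_d]) (`|cmod (f x)| `^ p))%E.
Proof.
move=> p2 d0; have [n0 [n0d /choice[N NP]]] := dyadic_maximal_le R d f d0.
pose g z := Normc.normc (f z) `^ (p / 2).
have p0 : 0 < p by lra.
have normc_ge0 z : 0 <= Normc.normc (f z).
  by case: (f z) => a b; exact: sqrtr_ge0.
have sqr_half a : 0 <= a -> (a `^ (p / 2)) ^+ 2 = a `^ p.
  by move=> a0; rewrite -powR_mulrn ?powR_ge0// -powRrM divfK.
apply: ge_ereal_sup => _ [X [finX _] <-].
have [Y uY Yle] := lattice_maximal R d n0 g (fset_set X) N n0d
  (fun x => (NP x).1) (fun x => powR_ge0 _ _) (fset_uniq _).
rewrite fsbig_finite//; apply: (@le_trans _ _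
    (\sum_(x <- fset_set X) lattice_average R d (N x) g x ^+ 2)%:E).
  rewrite -sumEFin; apply: lee_sum => x _.
  have [_ /andP[dm0 dm_le]] := NP x.
  rewrite gee0_abs//; set L := lattice_average R d _ _ _ in dm_le.
  have L0 : 0 <= L by rewrite mulr_ge0 ?invr_ge0// sumr_ge0.
  apply: (@le_trans _ _ (L%:E `^ p)%E).
    apply: gt0_ler_poweR => //; rewrite ?(ltW p0)// in_itv/= ?dm0 ?leey//.
    by rewrite lee_fin L0.
  rewrite poweR_EFin lee_fin -sqr_half// ler_pXn2r ?nnegrE ?powR_ge0//.
    by apply: mean_powR => //; lra.
  by rewrite mulr_ge0 ?invr_ge0// sumr_ge0// => y _; exact: powR_ge0.
apply: (@le_trans _ _ (32 ^+ 2 * \sum_(y <- Y) g y ^+ 2)%:E).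
  by rewrite lee_fin.
have Y0 : 0 <= \sum_(y <- Y) g y ^+ 2.
  by apply: sumr_ge0 => y _; exact: sqr_ge0.
(* The constant 32 of [lattice_maximal] is enlarged to 40 here. *)
rewrite EFinM lee_pmul ?lee_fin//; first by lra.
apply: esum_ge; exists [set` Y]%classic; first by split=> //; exact: finite_seq.
rewrite -fsbig_seq// -sumEFin; apply: lee_sum => y _.
by rewrite /cmod gee0_abs ?lee_fin// sqr_half.
Qed.

Theorem theorem1p1 (R : realType) (p : R) (hp : 2 <= p) (d : nat)
    (hd : (4 <= d)%N) (f : 'rV[int]_d -> R[i]) (hf : in_lp p f) :
  (lpnorm p (dyadic_maximal_B1 f) <=
   (40 `^ (2 / p))%:E * lpnorm p (fun x => cmod (f x)))%E.
Proof.
have p0 : 0 < p by lra.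
have esum_ge0 (g : 'rV[int]_d -> \bar R) :
  (0 <= \esum_(x in [set: 'rV[int]_d]) (`|g x| `^ p))%E.
  by apply: esum_ge0 => x _; exact: poweR_ge0.
(* As $40^{2/p} = (40^2)^{1/p}$, both sides become $1/p$-th powers and the sums themselves can be
   compared. *)
rewrite /lpnorm powRrM -poweR_EFin -poweRM ?esum_ge0 ?lee_fin ?powR_ge0//.
apply: gt0_ler_poweR; rewrite ?invr_ge0 ?(ltW p0)//.
- by rewrite in_itv/= esum_ge0 leey.
- rewrite in_itv/= leey andbT; apply: mule_ge0; last exact: (esum_ge0 (fun x => cmod (f x))).
  by rewrite lee_fin powR_ge0.
rewrite powR_mulrn//; apply: esum_dyadic_maximal_le => //.
exact: leq_trans hd.
Qed.
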